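(* Let $K=\{x\in\mathcal H: a^\top x\le b\}$ be a superincreasing knapsack with greedy solution $\theta$, where $\mathcal H=\{x\in\mathbb{Z}^n_+: x_i\le u_i\ \forall i\}$. Then $K=\{x\in\mathcal H: x\preccurlyeq\theta\}$.
   Context: Let $n\ge 1$, $N=\{1,\dots,n\}$, and let $b$, $a_i$, $u_i$ ($i\in N$) be positive integers with $a_iu_i\le b$ for all $i\in N$ and $a^\top u>b$ (standing assumptions). $K$ is a superincreasing knapsack if $\sum_{k=1}^{i}a_ku_k\le a_{i+1}$ for all $1\le i\le n-1$. The greedy solution $\theta\in\mathbb{Z}^n_+$ is defined recursively for $i=n,n-1,\dots,1$ by $\theta_i=\min\{u_i,\lfloor (b-\sum_{k=i+1}^n a_k\theta_k)/a_i\rfloor\}$. Lexicographic order (read from the last coordinate): $v^1\preccurlyeq v^2$ if $v^1=v^2$ or, with $i$ the largest index such that $v^1_i\ne v^2_i$, one has $v^1_i<v^2_i$. *)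

(* Defs.v *)
From mathcomp Require Import all_boot all_order all_algebra.
Set Implicit Arguments.
Unset Strict Implicit.
Unset Printing Implicit Defensive.
Import Order.TTheory GRing.Theory Num.Theory.
Local Open Scope ring_scope.

(* Coordinates are numbered from 0: index [i : 'I_n] is coordinate i + 1 of the
   mathematical text. *)
Definition zvec (n : nat) := {ffun 'I_n -> int}.

Definition box (n : nat) (u : zvec n) : pred (zvec n) :=
  [pred x : zvec n | [forall i, 0 <= x i <= u i]].

Definition knapsack (n : nat) (a u : zvec n) (b : int) : pred (zvec n) :=
  [pred x : zvec n | (x \in box u) && (\sum_(i < n) a i * x i <= b)].

(* [j] stands for the index i + 1 in "a_1 u_1 + ... + a_i u_i <= a_(i+1) for
   1 <= i <= n - 1"; hence the restriction to nonzero [j]. *)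
Definition superincreasing (n : nat) (a u : zvec n) : Prop :=
  forall j : 'I_n, (0 < j)%N -> \sum_(k < n | (k < j)%N) a k * u k <= a j.

(* For a positive divisor, [divz] is the floor of the rational quotient. The
   equations determine [theta] from the last coordinate down; see
   [is_greedy_exists_unique]. *)
Definition is_greedy (n : nat) (a u : zvec n) (b : int) (theta : zvec n) : Prop :=
  forall i : 'I_n,
    theta i =
    Num.min (u i) ((b - \sum_(k < n | (i < k)%N) a k * theta k) %/ a i)%Z.

(* Lexicographic order in which the last coordinate is the most significant. *)
Definition lexle (n : nat) (v w : zvec n) : bool :=
  (v == w) ||
  [exists i : 'I_n, (v i < w i) && [forall k : 'I_n, (i < k)%N ==> (v k == w k)]].

Lemma is_greedy_exists_unique (n : nat) (a u : zvec n) (b : int) :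
  exists! theta : zvec n, is_greedy a u b theta.
Proof.
pose step (t : zvec n) : zvec n := [ffun i : 'I_n =>
  Num.min (u i) ((b - \sum_(k < n | (i < k)%N) a k * t k) %/ a i)%Z].
have stepE (t t' : zvec n) (i : 'I_n) :
    (forall k : 'I_n, (i < k)%N -> t k = t' k) -> step t i = step t' i.
  move=> eq_t; rewrite !ffunE; congr (Num.min _ ((b - _) %/ _)%Z).
  by apply: eq_bigr => k lt_ik; rewrite eq_t.
have iterE m (t t' : zvec n) (i : 'I_n) :
    (n <= i + m)%N -> iter m step t i = iter m step t' i.
  elim: m i => [|m IHm] i le_n; first by rewrite addn0 leqNgt ltn_ord in le_n.
  rewrite !iterS; apply: stepE => k lt_ik; apply: IHm.
  by rewrite (leq_trans le_n) // addnS -addSn leq_add2r.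
exists (iter n step 0); split=> [i|t greedy_t].
  rewrite (iterE _ 0 (step 0)) ?leq_addl // -iterSr iterS.
  by rewrite [LHS]ffunE.
have fix_t : step t = t by apply/ffunP=> i; rewrite ffunE -greedy_t.
have iter_t m : iter m step t = t by elim: m => //= m ->.
rewrite -(iter_t n).
by apply/ffunP=> i; apply: iterE; rewrite leq_addl.
Qed.

(* Main.v *)
Require Import Defs.
From mathcomp Require Import all_boot all_order all_algebra.
Import Order.TTheory GRing.Theory Num.Theory.
Local Open Scope ring_scope.

(** Let [i] be the largest index where [x] and [theta] differ, so that they share
    the weight [t] of the coordinates above [i].
    If [x i < theta i], superincreasingness bounds the weight of [x] below [i] by
    [a i], so the total is at most [a i * theta i + t <= b].
    If [theta i < x i <= u i], the minimum defining [theta i] is the floor of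
    [(b - t) / a i], which [x i] exceeds, so already [a i * x i + t > b]. *)

Lemma sum_ord_split (V : nmodType) (n : nat) (i : 'I_n) (F : 'I_n -> V) :
  \sum_(k < n) F k =
  \sum_(k < n | (k < i)%N) F k + (F i + \sum_(k < n | (i < k)%N) F k).
Proof.
rewrite (bigID (fun k : 'I_n => (k < i)%N)) /=; congr (_ + _).
rewrite (bigD1 i) ?ltnn //=; congr (_ + _); apply: eq_bigl => k.
by rewrite -leqNgt ltn_neqAle andbC eq_sym.
Qed.

(** Either the vectors agree everywhere, or the largest index at which they differ decides. The
    failing case keeps that index as a witness, which a bare negation of [lexle] would hide. *)
Lemma lexle_total_cases (n : nat) (v w : zvec n) :
  lexle v w \/
  exists2 i : 'I_n, w i < v i & forall k : 'I_n, (i < k)%N -> v k = w k.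
Proof.
have [/forallP eq_vw | /forallPn[i0 ne_i0]] := boolP [forall k, v k == w k].
  by left; apply/orP; left; apply/eqP/ffunP => k; apply/eqP.
case: (@arg_maxnP _ i0 (fun i => v i != w i) val ne_i0) => i ne_i max_i.
have eq_above (k : 'I_n) : (i < k)%N -> v k = w k.
  by move=> lt_ik; apply/eqP; apply: contraTT lt_ik => /max_i; rewrite -leqNgt.
have [lt_vw | lt_wv | eq_i] := ltgtP (v i) (w i).
- left; apply/orP; right; apply/existsP; exists i; rewrite lt_vw /=.
  by apply/forallP => k; apply/implyP => /eq_above ->.
- by right; exists i.
- by rewrite eq_i eqxx in ne_i.
Qed.

(** Extends the superincreasing bound to index 0, where the sum is empty and [0 < a i] suffices. *)
Lemma superincreasing_sum_le (n : nat) (a u : zvec n) (i : 'I_n) :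
  (forall j, 0 < a j) -> superincreasing a u ->
  \sum_(k < n | (k < i)%N) a k * u k <= a i.
Proof.
move=> a_gt0 a_si; have [i0 | i_gt0] := posnP i; last exact: a_si.
by rewrite big_pred0 ?ltW // => k; rewrite i0.
Qed.

Section Greedy.

Variables (n : nat) (a u theta : zvec n) (b : int).
Hypotheses (a_gt0 : forall i, 0 < a i) (theta_greedy : is_greedy a u b theta).

(** The minimum is at most its floor term; multiplying by [a i > 0] undoes the division. *)
Lemma greedy_tail_le (i : 'I_n) :
  a i * theta i + \sum_(k < n | (i < k)%N) a k * theta k <= b.
Proof.
rewrite -lerBrDr mulrC -lez_divRL // [theta i]theta_greedy.
by rewrite ge_min lexx orbT.
Qed.

Lemma greedy_maximal (i : 'I_n) (z : int) : z <= u i -> theta i < z ->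
  b < a i * z + \sum_(k < n | (i < k)%N) a k * theta k.
Proof.
move=> z_le; rewrite [theta i]theta_greedy gt_min ltNge z_le /=.
by rewrite ltz_divLR // ltrBlDr mulrC.
Qed.

Lemma greedy_weight_le : (0 < n)%N -> \sum_(i < n) a i * theta i <= b.
Proof.
(* No coordinate lies below index 0, so the tail bound there covers the whole sum. *)
move=> n_gt0; rewrite (sum_ord_split _ _ (Ordinal n_gt0)).
by rewrite big_pred0 // add0r greedy_tail_le.
Qed.

Lemma lexle_greedy_weight_le (x : zvec n) :
  (0 < n)%N -> superincreasing a u -> x \in box u -> lexle x theta ->
  \sum_(i < n) a i * x i <= b.
Proof.
move=> n_gt0 a_si /forallP x_box /orP[/eqP -> | ]; first exact: greedy_weight_le.
case/existsP => i /andP[lt_i /forallP eq_above].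
apply: le_trans (greedy_tail_le i); rewrite (sum_ord_split _ _ i) addrA.
rewrite [X in _ + X <= _](eq_bigr (fun k => a k * theta k)); last first.
  by move=> k lt_ik; rewrite (eqP (implyP (eq_above k) lt_ik)).
(* One extra copy of [a i] pays for all coordinates below [i]; by integrality [x i < theta i] leaves
   room for it. *)
rewrite lerD2r; apply: (@le_trans _ _ (a i * (1 + x i))).
  rewrite mulrDr mulr1 lerD2r.
  apply: le_trans (superincreasing_sum_le _ a u i a_gt0 a_si).
  by apply: ler_sum => k _; rewrite ler_pM2l //; case/andP: (x_box k).
by rewrite ler_pM2l // addrC lezD1.
Qed.

Lemma weight_le_lexle_greedy (x : zvec n) :
  x \in box u -> \sum_(i < n) a i * x i <= b -> lexle x theta.
Proof.
move=> /forallP x_box x_le; have [// | [i lt_i eq_above]] := lexle_total_cases n x theta.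
have /andP[_ xi_le] := x_box i.
have := greedy_maximal i (x i) xi_le lt_i; rewrite ltNge => /negP[].
apply: le_trans x_le; rewrite (sum_ord_split _ _ i).
rewrite [X in _ <= _ + (_ + X)](eq_bigr (fun k => a k * theta k)); last first.
  by move=> k /eq_above ->.
(* What remains is the weight of [x] below [i], nonnegative since [x] lies in the box. *)
rewrite lerDr; apply: sumr_ge0 => k _.
by apply: mulr_ge0; [exact: ltW | case/andP: (x_box k)].
Qed.

End Greedy.

Theorem proposition1 (n : nat) (a u theta : zvec n) (b : int)
    (n_ge1 : (1 <= n)%N)
    (b_gt0 : 0 < b)
    (a_gt0 : forall i : 'I_n, 0 < a i)
    (u_gt0 : forall i : 'I_n, 0 < u i)
    (au_le_b : forall i : 'I_n, a i * u i <= b)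
    (au_gt_b : b < \sum_(i < n) a i * u i)
    (a_superincreasing : superincreasing a u)
    (theta_greedy : is_greedy a u b theta) :
  knapsack a u b =i [pred x : zvec n | (x \in box u) && lexle x theta].
Proof.
move=> x; apply/idP/idP => /andP[x_box x_le]; apply/andP; split=> //.
- exact: weight_le_lexle_greedy x_le.
- exact: lexle_greedy_weight_le x_le.
Qed.
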